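(* Let $\gamma_y \ge 0$ be a real constant and define $$\mathcal{F}_1(s+\sigma,k_x) = \frac{1}{s+\sigma}\left(\sqrt{(s+\sigma)^2+k_x^2}+\gamma_y (s+\sigma)\right).$$ The equation $\mathcal{F}_1(s+\sigma,k_x)=0$ has no solution for all $s\in\mathbb{C}$ with $\Re s\ge 0$, all $k_x\in\mathbb{R}$ and all real $\sigma>0$.
   Context: For complex $z$, the square root $\sqrt{z}$ is the branch defined by $-\pi<\arg z\le \pi$ and $\arg\sqrt{z}=\tfrac12\arg z$. *)

(* Defs.v *)
From Stdlib Require Import Reals Lra Psatz.
From Coquelicot Require Import Coquelicot.

Open Scope R_scope.
Open Scope C_scope.

(* Principal argument, with values in (-PI, PI]: negative reals get PI.
   The value at 0, where the argument is undefined, is immaterial. *)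
Definition Carg (z : C) : R :=
  (if Rlt_dec (Im z) 0 then - acos (Re z / Cmod z) else acos (Re z / Cmod z))%R.

(* |sqrt z| = |z|^(1/2) and arg (sqrt z) = arg z / 2; see [Csqrt_sqr] and
   [Carg_Csqrt]. *)
Definition Csqrt (z : C) : C :=
  RtoC (sqrt (Cmod z)) * (cos (Carg z / 2)%R, sin (Carg z / 2)%R).

(* Only meaningful for w <> 0, since [/ 0 = 0] in [C]. *)
Definition F1 (gamma_y : R) (w : C) (k_x : R) : C :=
  RtoC 1 / w * (Csqrt (w ^ 2 + RtoC k_x ^ 2) + RtoC gamma_y * w).

Lemma Cmod_Re_Im (z : C) : (Cmod z * Cmod z = Re z * Re z + Im z * Im z)%R.
Proof.
  unfold Cmod, Re, Im. rewrite sqrt_sqrt; [ring | nra].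
Qed.

Lemma Re_div_Cmod (z : C) : z <> 0 -> (-1 <= Re z / Cmod z <= 1)%R.
Proof.
  intros Hz. assert (H0 := Cmod_gt_0 z). apply H0 in Hz.
  assert (H := Cmod_Re_Im z).
  split.
  - apply Rle_div_r; nra.
  - apply Rle_div_l; nra.
Qed.

Lemma Carg_bound (z : C) : z <> 0 -> (- PI < Carg z <= PI)%R.
Proof.
  intros Hz. assert (Hb := Re_div_Cmod z Hz).
  assert (Hm := proj1 (Cmod_gt_0 z) Hz). assert (H := Cmod_Re_Im z).
  assert (Ha := acos_bound (Re z / Cmod z)). assert (HPI := PI_RGT_0).
  unfold Carg. destruct (Rlt_dec (Im z) 0) as [Hi | Hi]; [|lra].
  assert (-1 < Re z / Cmod z < 1)%R as Hs.
  { split; [apply Rlt_div_r | apply Rlt_div_l]; nra. }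
  apply acos_bound_lt in Hs. lra.
Qed.

Lemma Carg_polar (z : C) :
  z <> 0 -> z = RtoC (Cmod z) * (cos (Carg z), sin (Carg z)).
Proof.
  intros Hz. assert (Hb := Re_div_Cmod z Hz).
  assert (Hm := proj1 (Cmod_gt_0 z) Hz). assert (H := Cmod_Re_Im z).
  assert (Hc : cos (Carg z) = (Re z / Cmod z)%R).
  { unfold Carg. destruct (Rlt_dec (Im z) 0); rewrite ?cos_neg; now apply cos_acos. }
  assert (Hs : (Cmod z * sin (acos (Re z / Cmod z)) = Rabs (Im z))%R).
  { rewrite sin_acos by exact Hb.
    rewrite <- (sqrt_Rsqr (Cmod z)) at 1 by lra.
    rewrite <- sqrt_mult_alt by apply Rle_0_sqr.
    rewrite <- sqrt_Rsqr_abs. f_equal. unfold Rsqr.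
    replace (Im z * Im z)%R with (Cmod z * Cmod z - Re z * Re z)%R by lra.
    field. lra. }
  assert (Hs' : (Cmod z * sin (Carg z) = Im z)%R).
  { unfold Carg. destruct (Rlt_dec (Im z) 0).
    - rewrite sin_neg. rewrite Rabs_left in Hs by assumption. lra.
    - rewrite Rabs_pos_eq in Hs by lra. exact Hs. }
  rewrite Hc. destruct z as [x y]. unfold Cmult, RtoC; simpl in *.
  apply injective_projections; simpl.
  - field. lra.
  - rewrite <- Hs' at 1. ring.
Qed.

Lemma Carg_unique (z : C) (r t : R) :
  (0 < r)%R -> (- PI < t <= PI)%R -> z = RtoC r * (cos t, sin t) -> Carg z = t.
Proof.
  intros Hr Ht ->.
  assert (Hm : Cmod (RtoC r * (cos t, sin t)) = r).
  { rewrite Cmod_mult, Cmod_R, Rabs_pos_eq by lra. unfold Cmod; simpl.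
    replace (_ + _)%R with 1%R; [rewrite sqrt_1; ring |].
    assert (H := sin2_cos2 t). unfold Rsqr in H. lra. }
  unfold Carg. rewrite Hm. simpl.
  replace ((r * cos t - 0 * sin t) / r)%R with (cos t) by (field; lra).
  replace (r * sin t + 0 * cos t)%R with (r * sin t)%R by ring.
  destruct (Rlt_dec (r * sin t) 0) as [H | H].
  - assert (t < 0)%R.
    { destruct (Rlt_le_dec t 0); [assumption |].
      assert (0 <= sin t)%R by (apply sin_ge_0; lra). nra. }
    rewrite <- cos_neg, acos_cos; lra.
  - assert (0 <= t)%R.
    { destruct (Rlt_le_dec t 0); [|assumption].
      assert (sin t < 0)%R by (apply sin_lt_0_var; lra). nra. }
    rewrite acos_cos; lra.
Qed.

Lemma Csqrt_sqr (z : C) : Csqrt z * Csqrt z = z.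
Proof.
  destruct (Ceq_dec z 0) as [-> | Hz].
  { unfold Csqrt. rewrite Cmod_0, sqrt_0. ring. }
  rewrite (Carg_polar z Hz) at 3. unfold Csqrt.
  assert (Hr := sqrt_sqrt (Cmod z) (Cmod_ge_0 z)).
  replace (Carg z) with (2 * (Carg z / 2))%R at 5 6 by field.
  rewrite cos_2a, sin_2a. rewrite <- Hr at 3.
  apply injective_projections; simpl; ring.
Qed.

Lemma Carg_Csqrt (z : C) : z <> 0 -> Carg (Csqrt z) = (Carg z / 2)%R.
Proof.
  intros Hz. assert (H := Carg_bound z Hz). assert (HPI := PI_RGT_0).
  apply (Carg_unique _ (sqrt (Cmod z))).
  - apply sqrt_lt_R0. now apply Cmod_gt_0.
  - lra.
  - reflexivity.
Qed.

(* Main.v *)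
Require Import Defs.
From Stdlib Require Import Reals Psatz.
From Coquelicot Require Import Coquelicot.

(** Put [w = s + sigma], which lies in the open right half-plane. A zero of
    [F1] forces [Csqrt (w ^ 2 + k_x ^ 2) = - gamma_y w]. The principal square
    root takes values in the closed right half-plane ([Re_Csqrt_ge_0]), while
    the right-hand side has real part [- gamma_y (Re w) <= 0]. Both real parts
    therefore vanish, so [gamma_y = 0], and then [w ^ 2 + k_x ^ 2 = 0]. This
    places [w] at [i k_x] or [- i k_x], on the imaginary axis
    ([sqr_add_sqr_neq_0]), which is impossible. *)

Open Scope R_scope.
Open Scope C_scope.

(** Halving the principal argument brings it into [(-PI/2, PI/2]], where the
    cosine is nonnegative. *)
Lemma Re_Csqrt_ge_0 (z : C) : (0 <= Re (Csqrt z))%R.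
Proof.
  destruct (Ceq_dec z 0) as [-> | Hz].
  { unfold Csqrt. rewrite Cmod_0, sqrt_0. simpl. lra. }
  assert (Hb := Carg_bound z Hz).
  assert (Hc : (0 <= cos (Carg z / 2))%R) by (apply cos_ge_0; lra).
  assert (Hm := sqrt_pos (Cmod z)).
  unfold Csqrt. simpl. nra.
Qed.

(** The imaginary part [2 (Re w) (Im w)] of the sum vanishes only for real
    [w], and then the real part is at least [(Re w) ^ 2 > 0]. *)
Lemma sqr_add_sqr_neq_0 (w : C) (k : R) :
  (0 < Re w)%R -> w ^ 2 + RtoC k ^ 2 <> 0.
Proof.
  destruct w as [a b]; simpl. intros Ha H.
  injection H as Hre Him. simpl in Hre, Him.
  assert (Hb : b = 0%R) by nra.
  subst b. nra.
Qed.

Theorem lemma4p2 (gamma_y : R) (hgamma : (0 <= gamma_y)%R) :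
  forall (s : C) (k_x sigma : R),
    (0 <= Re s)%R -> (0 < sigma)%R ->
    ~ (F1 gamma_y (s + RtoC sigma) k_x = RtoC 0).
Proof.
  intros s k_x sigma Hs Hsigma HF.
  assert (Hw : (0 < Re (s + RtoC sigma))%R)
    by (destruct s; simpl in *; lra).
  revert Hw HF. generalize (s + RtoC sigma) as w. intros w Hw HF.
  assert (Hw0 : w <> 0) by (intros ->; simpl in Hw; lra).
  assert (Hnz := sqr_add_sqr_neq_0 w k_x Hw).
  assert (Hre := Re_Csqrt_ge_0 (w ^ 2 + RtoC k_x ^ 2)).
  assert (Hsq := Csqrt_sqr (w ^ 2 + RtoC k_x ^ 2)).
  unfold F1 in HF. revert Hnz Hre Hsq HF.
  generalize (w ^ 2 + RtoC k_x ^ 2) as z. intros z Hnz Hre Hsq HF.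
  assert (Hsum : Csqrt z + RtoC gamma_y * w = 0).
  { transitivity (w * (RtoC 1 / w * (Csqrt z + RtoC gamma_y * w))).
    - now field.
    - rewrite HF. ring. }
  assert (Hg : gamma_y = 0%R).
  { assert (HR := f_equal Re Hsum). simpl in Hre, HR.
    unfold Re in Hw. apply Rle_antisym; nra. }
  subst gamma_y. apply Hnz.
  assert (Hroot : Csqrt z = 0) by (rewrite <- Hsum; ring).
  rewrite <- Hsq, Hroot. ring.
Qed.
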